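(* Let $\{\tilde C,\tilde C_1\}$ be dual Mannheim partner curves in $\mathbb{D}^3$, with dual arc lengths $\tilde s,\tilde s_1$, dual curvatures $\tilde\kappa,\tilde\kappa_1$ and dual torsions $\tilde\tau,\tilde\tau_1$ respectively, and let $\tilde\theta$ be the dual angle between the dual tangents $\vec{\tilde t}$ and $\vec{\tilde t}_1$ at corresponding points. Then the following equations hold: (i) $\tilde\kappa_1=-\dfrac{d\tilde\theta}{d\tilde s_1}$, (ii) $\tilde\tau_1=\sin\tilde\theta\;\tilde\kappa\,\dfrac{d\tilde s}{d\tilde s_1}-\cos\tilde\theta\;\tilde\tau\,\dfrac{d\tilde s}{d\tilde s_1}$, (iii) $\tilde\kappa=\sin\tilde\theta\;\tilde\tau_1\,\dfrac{d\tilde s_1}{d\tilde s}$, (iv) $\tilde\tau=-\cos\tilde\theta\;\tilde\tau_1\,\dfrac{d\tilde s_1}{d\tilde s}$.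
   Context: Dual numbers: $\mathbb{D}=\{a+\varepsilon a^*: a,a^*\in\mathbb{R}\}$ with $\varepsilon^2=0$. For a differentiable real function $f$, $f(x+\varepsilon x^* )=f(x)+\varepsilon x^*f'(x)$; in particular $\sin(x+\varepsilon x^* )=\sin x+\varepsilon x^*\cos x$ and $\cos(x+\varepsilon x^* )=\cos x-\varepsilon x^*\sin x$. $\mathbb{D}^3$ is the $\mathbb{D}$-module of dual vectors $\vec{\tilde a}=\vec a+\varepsilon\vec a^*$ ($\vec a,\vec a^*\in\mathbb{R}^3$), with $\langle\vec{\tilde a},\vec{\tilde b}\rangle=\langle\vec a,\vec b\rangle+\varepsilon(\langle\vec a,\vec b^*\rangle+\langle\vec a^*,\vec b\rangle)$ and, for $\vec a\neq\vec 0$, norm $\|\vec{\tilde a}\|=\|\vec a\|+\varepsilon\langle\vec a,\vec a^*\rangle/\|\vec a\|$. A dual space curve is $\tilde\alpha(t)=\alpha(t)+\varepsilon\alpha^*(t)$ with $\alpha,\alpha^*$ differentiable (as often as needed) curves in $\mathbb{R}^3$ depending on a real parameter $t$; its dual arc length is $\tilde s=\int\|\tilde\alpha'(t)\|\,dt$, and $\frac{d}{d\tilde s}=\left(\frac{d\tilde s}{dt}\right)^{-1}\frac{d}{dt}$. Its dual Frenet frame $\{\vec{\tilde t},\vec{\tilde n},\vec{\tilde b}\}$ (dual tangent $\vec{\tilde t}=d\tilde\alpha/d\tilde s$, principal normal, binormal) is orthonormal with $\vec{\tilde b}=\vec{\tilde t}\times\vec{\tilde n}$ and satisfies $\frac{d\vec{\tilde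 t}}{d\tilde s}=\tilde\kappa\vec{\tilde n}$, $\frac{d\vec{\tilde n}}{d\tilde s}=-\tilde\kappa\vec{\tilde t}+\tilde\tau\vec{\tilde b}$, $\frac{d\vec{\tilde b}}{d\tilde s}=-\tilde\tau\vec{\tilde n}$, where the dual-valued functions $\tilde\kappa,\tilde\tau$ are the dual curvature and dual torsion. Dual Mannheim pair (dual Mannheim partner curves): $\{\tilde C,\tilde C_1\}$ is a dual Mannheim pair if there is a correspondence between the points of the dual space curves $\tilde C$ (given by $\tilde\alpha(\tilde s)$) and $\tilde C_1$ (given by $\tilde\alpha_1(\tilde s_1)$) such that at corresponding points the principal normal line of $\tilde C$ coincides with the binormal line of $\tilde C_1$. Convention: the directions are chosen so that $\vec{\tilde n}=\vec{\tilde b}_1$ at corresponding points, and then $\tilde\alpha=\tilde\alpha_1+\tilde\lambda\vec{\tilde b}_1$ with $\tilde\lambda$ a nonzero constant dual number. Objects of $\tilde C_1$ carry the subscript $1$; corresponding points share the same underlying real parameter. The sign of the dual angle $\tilde\theta$ is fixed by $\vec{\tilde t}=\cos\tilde\theta\,\vec{\tilde t}_1+\sin\tilde\theta\,\vec{\tilde n}_1$, $\vec{\tilde b}=-\sin\tilde\theta\,\vec{\tilde t}_1+\cos\tilde\theta\,\vec{\tilde n}_1$.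
   Formalization: The conventions n = b₁, b = t×n, b₁ = t₁×n₁ and the two formulas fixing the sign of the dual angle contradict each other (they force sin θ = cos θ = 0); here each frame may have either orientation, b = ±t×n and b₁ = ±t₁×n₁, all else unchanged. *)

(* Defs.v *)
From HB Require Import structures.
From mathcomp Require Import all_boot all_order all_algebra.
From mathcomp Require Import all_classical all_reals all_analysis.
From mathcomp Require Import ring.

Set Implicit Arguments.
Unset Strict Implicit.
Unset Printing Implicit Defensive.

Import Order.TTheory GRing.Theory Num.Theory.
Import numFieldNormedType.Exports.

Local Open Scope classical_set_scope.
Local Open Scope ring_scope.

(* [Dual a b] is the dual number a + eps b, where eps^2 = 0.                  *)
Record dualnum (R : Type) := Dual { dre : R ; ddu : R }.

Section DualRing.
Variable F : fieldType.
Implicit Types x y z : dualnum F.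

Definition pair_of_dual x := (dre x, ddu x).
Definition dual_of_pair (p : F * F) := Dual p.1 p.2.
Lemma pair_of_dualK : cancel pair_of_dual dual_of_pair.
Proof. by case. Qed.

HB.instance Definition _ := Choice.copy (dualnum F) (can_type pair_of_dualK).

Lemma dualP x y : dre x = dre y -> ddu x = ddu y -> x = y.
Proof. by case: x y => [a b] [c d] /= -> ->. Qed.

Definition dual_add x y := Dual (dre x + dre y) (ddu x + ddu y).
Definition dual_opp x := Dual (- dre x) (- ddu x).

Fact dual_addA : associative dual_add.
Proof. by move=> x y z; apply: dualP; rewrite /= addrA. Qed.
Fact dual_addC : commutative dual_add.
Proof. by move=> x y; apply: dualP; rewrite /= addrC. Qed.
Fact dual_add0 : left_id (Dual 0 0) dual_add.
Proof. by move=> x; apply: dualP; rewrite /= add0r. Qed.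
Fact dual_addN : left_inverse (Dual 0 0) dual_opp dual_add.
Proof. by move=> x; apply: dualP; rewrite /= addNr. Qed.

HB.instance Definition _ := GRing.isZmodule.Build (dualnum F)
  dual_addA dual_addC dual_add0 dual_addN.

Definition dual_mul x y :=
  Dual (dre x * dre y) (dre x * ddu y + ddu x * dre y).

Fact dual_mulA : associative dual_mul.
Proof. by move=> x y z; apply: dualP => /=; ring. Qed.
Fact dual_mulC : commutative dual_mul.
Proof. by move=> x y; apply: dualP => /=; ring. Qed.
Fact dual_mul1 : left_id (Dual 1 0) dual_mul.
Proof. by move=> x; apply: dualP => /=; ring. Qed.
Fact dual_mulDl : left_distributive dual_mul +%R.
Proof. by move=> x y z; apply: dualP => /=; ring. Qed.
Fact dual_oner_neq0 : Dual 1 0 != 0 :> dualnum F.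
Proof. by apply/eqP => -[] /eqP; rewrite oner_eq0. Qed.

HB.instance Definition _ := GRing.Zmodule_isComNzRing.Build (dualnum F)
  dual_mulA dual_mulC dual_mul1 dual_mulDl dual_oner_neq0.

Definition dual_unit : pred (dualnum F) := fun x => dre x != 0.

(* As for every unitRingType, x^-1 = x when x is not a unit.                  *)
Definition dual_inv x :=
  if dual_unit x then Dual (dre x)^-1 (- ddu x / dre x ^+ 2) else x.

Fact dual_mulV : {in dual_unit, left_inverse 1 dual_inv *%R}.
Proof.
move=> x; rewrite unfold_in /dual_inv => ux; rewrite /dual_unit ux.
by apply: dualP => /=; field.
Qed.

Fact dual_unitP x y : y * x = 1 -> dual_unit x.
Proof.
move=> /(congr1 (@dre F)) /= yx1; apply/eqP => x0.
by move/eqP: yx1; rewrite x0 mulr0 eq_sym oner_eq0.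
Qed.

Fact dual_inv_out : {in [predC dual_unit], dual_inv =1 id}.
Proof. by move=> x; rewrite /dual_inv inE unfold_in /= => /negbTE; rewrite /dual_unit => ->. Qed.

HB.instance Definition _ := GRing.ComNzRing_hasMulInverse.Build (dualnum F)
  dual_mulV dual_unitP dual_inv_out.

End DualRing.

Section Vectors.
Variable K : comNzRingType.
Implicit Types u v : 'rV[K]_3.

Definition dotv u v : K := \sum_i u 0 i * v 0 i.

(* The indices i + 1 and i + 2 are taken modulo 3.                            *)
Definition crossv u v : 'rV[K]_3 :=
  \row_(i < 3) (u 0 (i + 1) * v 0 (i + 2) - u 0 (i + 2) * v 0 (i + 1)).

Definition linev u v : set 'rV[K]_3 := [set u + x *: v | x in [set: K]].

End Vectors.

Section DualAnalysis.
Variable R : realType.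
Notation D := (dualnum R).
Notation D3 := ('rV[dualnum R]_3).

Definition drev (u : D3) : 'rV[R]_3 := map_mx (@dre R) u.
Definition dduv (u : D3) : 'rV[R]_3 := map_mx (@ddu R) u.

Lemma dotv_dualE (u v : D3) :
  dotv u v = Dual (dotv (drev u) (drev v))
                  (dotv (drev u) (dduv v) + dotv (dduv u) (drev v)).
Proof.
rewrite /dotv !big_ord_recr !big_ord0 !mxE /=.
by apply: dualP => /=; ring.
Qed.

(* Euclidean; the library norm `|v| on row vectors is the sup norm.           *)
Definition enorm (v : 'rV[R]_3) : R := Num.sqrt (dotv v v).

(* Meaningful when drev u != 0.                                               *)
Definition dnorm (u : D3) : D :=
  Dual (enorm (drev u)) (dotv (drev u) (dduv u) / enorm (drev u)).

Definition dual_ext (f : R -> R) (x : D) : D :=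
  Dual (f (dre x)) (ddu x * derive1 f (dre x)).

Definition dsin : D -> D := dual_ext sin.
Definition dcos : D -> D := dual_ext cos.

Lemma dsinE x : dsin x = Dual (sin (dre x)) (ddu x * cos (dre x)).
Proof. by rewrite /dsin /dual_ext derive1E derive_val. Qed.

Lemma dcosE x : dcos x = Dual (cos (dre x)) (- (ddu x * sin (dre x))).
Proof. by rewrite /dcos /dual_ext derive1E derive_val mulrN. Qed.

Definition dderivable (f : R -> D) (t : R) : Prop :=
  derivable (fun u => dre (f u)) t 1 /\ derivable (fun u => ddu (f u)) t 1.

Definition dderive (f : R -> D) (t : R) : D :=
  Dual (derive1 (fun u => dre (f u)) t) (derive1 (fun u => ddu (f u)) t).

Definition vderivable (f : R -> D3) (t : R) : Prop :=
  forall i, dderivable (fun u => f u 0 i) t.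

Definition vderive (f : R -> D3) (t : R) : D3 :=
  \row_i dderive (fun u => f u 0 i) t.

(* d/ds = (ds/dt)^-1 d/dt, on dual functions and on dual vector functions.    *)
Definition ddiff (s f : R -> D) (t : R) : D := (dderive s t)^-1 * dderive f t.

Definition vdiff (s : R -> D) (f : R -> D3) (t : R) : D3 :=
  (dderive s t)^-1 *: vderive f t.

(* The functions attached to a dual space curve, all of the real parameter t. *)
Record frenet_data := FrenetData {
  curve : R -> D3 ;
  arclen : R -> D ;
  tangent : R -> D3 ;
  normal : R -> D3 ;
  binormal : R -> D3 ;
  curvature : R -> D ;
  torsion : R -> D }.

(* The arc length is any primitive of the dual speed, the curve being regular.
   The frame satisfies b = t x n if ~~ o, and b = - (t x n) if o. Both
   orientations are needed: if n = b1, then the relations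
     t = cos(theta) t1 + sin(theta) n1,  b = - sin(theta) t1 + cos(theta) n1
   force the frames (t, n, b) and (t1, n1, b1) to have opposite orientations. *)
Record is_frenet (I : set R) (o : bool) (C : frenet_data) : Prop := IsFrenet {
  curve_derivable : forall t, I t -> vderivable (curve C) t ;
  curve_regular : forall t, I t -> drev (vderive (curve C) t) != 0 ;
  arclen_derivable : forall t, I t -> dderivable (arclen C) t ;
  arclenE : forall t, I t ->
    dderive (arclen C) t = dnorm (vderive (curve C) t) ;
  tangent_derivable : forall t, I t -> vderivable (tangent C) t ;
  normal_derivable : forall t, I t -> vderivable (normal C) t ;
  binormal_derivable : forall t, I t -> vderivable (binormal C) t ;
  tangentE : forall t, I t -> tangent C t = vdiff (arclen C) (curve C) t ;
  tangent_unit : forall t, I t -> dotv (tangent C t) (tangent C t) = 1 ;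
  normal_unit : forall t, I t -> dotv (normal C t) (normal C t) = 1 ;
  binormal_unit : forall t, I t -> dotv (binormal C t) (binormal C t) = 1 ;
  tangent_normal : forall t, I t -> dotv (tangent C t) (normal C t) = 0 ;
  tangent_binormal : forall t, I t -> dotv (tangent C t) (binormal C t) = 0 ;
  normal_binormal : forall t, I t -> dotv (normal C t) (binormal C t) = 0 ;
  binormalE : forall t, I t ->
    binormal C t = (-1) ^+ o *: crossv (tangent C t) (normal C t) ;
  frenet_tangent : forall t, I t ->
    vdiff (arclen C) (tangent C) t = curvature C t *: normal C t ;
  frenet_normal : forall t, I t ->
    vdiff (arclen C) (normal C) t =
      - (curvature C t *: tangent C t) + torsion C t *: binormal C t ;
  frenet_binormal : forall t, I t ->
    vdiff (arclen C) (binormal C) t = - (torsion C t *: normal C t) }.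

(* Corresponding points are those with the same parameter.                    *)
Definition mannheim_pair (I : set R) (C C1 : frenet_data) : Prop :=
  (forall t, I t ->
     linev (curve C t) (normal C t) = linev (curve C1 t) (binormal C1 t) /\
     normal C t = binormal C1 t) /\
  (exists lambda : D, lambda != 0 /\
     forall t, I t -> curve C t = curve C1 t + lambda *: binormal C1 t).

(* A differentiable determination of the signed angle from t1 to t.           *)
Definition is_dual_angle (I : set R) (C C1 : frenet_data) (theta : R -> D) :
    Prop :=
  forall t, I t ->
    [/\ dderivable theta t,
        tangent C t = dcos (theta t) *: tangent C1 t
                      + dsin (theta t) *: normal C1 t
      & binormal C t = - (dsin (theta t) *: tangent C1 t)
                       + dcos (theta t) *: normal C1 t ].

End DualAnalysis.

(* Main.v *)
Require Import Defs.
From HB Require Import structures.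
From mathcomp Require Import all_boot all_order all_algebra.
From mathcomp Require Import all_classical all_reals all_analysis.
From mathcomp Require Import ring.

Set Implicit Arguments.
Unset Strict Implicit.
Unset Printing Implicit Defensive.

Import Order.TTheory GRing.Theory Num.Theory.
Import numFieldNormedType.Exports.
Local Open Scope classical_set_scope.
Local Open Scope ring_scope.

(* Differentiating n = b1 and substituting n1 = sin(theta) t + cos(theta) b
   gives (iii) and (iv) by comparing the components along t and b; (ii) is
   their combination through sin^2 + cos^2 = 1. Differentiating
   t = cos(theta) t1 + sin(theta) n1 and pairing with b, which is orthogonal to
   t' and to b1, gives (i). *)

Section DotProduct.
Variable K : comNzRingType.
Implicit Types (u v w : 'rV[K]_3) (a : K).

Lemma dotvC u v : dotv u v = dotv v u.
Proof. by apply: eq_bigr => i _; rewrite mulrC. Qed.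

Lemma dotvDl u v w : dotv (u + v) w = dotv u w + dotv v w.
Proof. by rewrite -big_split; apply: eq_bigr => i _; rewrite mxE mulrDl. Qed.

Lemma dotvZl a u w : dotv (a *: u) w = a * dotv u w.
Proof. by rewrite mulr_sumr; apply: eq_bigr => i _; rewrite mxE mulrA. Qed.

Lemma dotvNl u w : dotv (- u) w = - dotv u w.
Proof. by rewrite -scaleN1r dotvZl mulN1r. Qed.

Definition dotvl := (dotvDl, dotvNl, dotvZl).

Lemma addvE u v i : (u + v) 0 i = u 0 i + v 0 i.
Proof. exact: mxE. Qed.

Lemma lincombE a b u v i :
  (a *: u + b *: v) 0 i = a * u 0 i + b * v 0 i.
Proof. by rewrite !mxE. Qed.

End DotProduct.

(* [v], [v1], [w] stand for ds/dt, ds1/dt, dtheta/dt, and [dn], [dt] are the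
   t-derivatives of n = b1 and of t = c t1 + s n1. *)
Lemma mannheim_frames (K : comUnitRingType) (tg bn tg1 nm1 bn1 : 'rV[K]_3)
    (c s v v1 w k k1 x x1 : K) :
    v \is a GRing.unit -> v1 \is a GRing.unit -> c ^+ 2 + s ^+ 2 = 1 ->
    tg = c *: tg1 + s *: nm1 -> bn = - (s *: tg1) + c *: nm1 ->
    dotv tg tg = 1 -> dotv bn bn = 1 -> dotv tg bn = 0 ->
    dotv tg1 tg1 = 1 -> dotv nm1 nm1 = 1 -> dotv tg1 nm1 = 0 ->
    dotv bn1 bn = 0 ->
  forall (dn : v *: (- (k *: tg) + x *: bn) = v1 *: - (x1 *: nm1))
    (dt : v *: (k *: bn1) =
      (- s * w) *: tg1 + c *: (v1 *: (k1 *: nm1)) +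
      ((c * w) *: nm1 + s *: (v1 *: (- (k1 *: tg1) + x1 *: bn1)))),
  [/\ k1 = - (v1^-1 * w),
      x1 = s * k * (v1^-1 * v) - c * x * (v1^-1 * v),
      k = s * x1 * (v^-1 * v1)
    & x = - (c * x1 * (v^-1 * v1))].
Proof.
move=> uv uv1 cs tE bE tt bb tb tt1 nn1 tn1 b1b dn dt.
have nt1 : dotv nm1 tg1 = 0 by rewrite dotvC.
have bt : dotv bn tg = 0 by rewrite dotvC.
(* The rotation by the angle is inverted by transposition: these are the components of [nm1] along
   [tg] and [bn], and of [tg1] along [bn]. *)
have n1t : dotv nm1 tg = s.
  by rewrite dotvC tE !dotvl tn1 nn1 mulr0 add0r mulr1.
have n1b : dotv nm1 bn = c.
  by rewrite dotvC bE !dotvl tn1 nn1 mulr0 oppr0 add0r mulr1.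
have t1b : dotv tg1 bn = - s.
  by rewrite dotvC bE !dotvl tt1 nt1 mulr0 addr0 mulr1.
have := congr1 (fun u => dotv u tg) dn.
have := congr1 (fun u => dotv u bn) dn.
have := congr1 (fun u => dotv u bn) dt.
rewrite /= !dotvl tt bb tb bt n1t n1b t1b b1b => eb en et.
have kE : v * k = s * x1 * v1.
  apply: oppr_inj; transitivity (v1 * - (x1 * s)); last by ring.
  by rewrite -et; ring.
have xE : v * x = - (c * x1 * v1).
  transitivity (v1 * - (x1 * c)); last by ring.
  by rewrite -en; ring.
split.
(* The claim becomes [v1 * k1 + w = 0]. The pairing [eb] shows this sum multiplied by
   [c ^+ 2 + s ^+ 2], hence the factor 1 written that way. *)
- apply: (mulrI uv1); rewrite mulrN mulVKr //; apply/eqP.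
  rewrite -addr_eq0 -[_ + _]mul1r -cs; apply/eqP.
  by transitivity (v * (k * 0)); [rewrite eb; ring | rewrite !mulr0].
- apply: (mulrI uv1).
  (* Regrouped so that [v * k] and [v * x] appear, ready for [kE] and [xE]. *)
  have -> : v1 * (s * k * (v1^-1 * v) - c * x * (v1^-1 * v)) =
    v1 * v1^-1 * (s * (v * k) - c * (v * x)) by ring.
  by rewrite mulrV // mul1r kE xE -[LHS]mulr1 -cs; ring.
- by rewrite mulrCA -kE mulKr.
- by rewrite mulrCA -mulrN -xE mulKr.
Qed.

Section DualCalculus.
Variable R : realType.
Implicit Types (f g : R -> dualnum R) (t : R) (a b : dualnum R).
Implicit Types (U V : R -> 'rV[dualnum R]_3).

(** A relation rather than a value, so that each differentiation rule carries derivability along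
    with the derivative. *)
Definition is_dderive f t a :=
  is_derive t 1 (fun u => dre (f u)) (dre a) /\
  is_derive t 1 (fun u => ddu (f u)) (ddu a).

Lemma dderivableP f t : dderivable f t -> is_dderive f t (dderive f t).
Proof.
move=> [fd fd']; rewrite /is_dderive /dderive /= !derive1E.
by split; apply: derivableP.
Qed.

Lemma is_dderive_val f t a : is_dderive f t a -> dderive f t = a.
Proof. by move=> [fd fd']; apply: dualP; rewrite /= derive1E derive_val. Qed.

Lemma is_dderiveD f g t a b : is_dderive f t a -> is_dderive g t b ->
  is_dderive (fun u => f u + g u) t (a + b).
Proof. by move=> [? ?] [? ?]; split; exact: is_deriveD. Qed.

(** The dual part of a product is a sum of two real products, so the real product rule is applied
    three times in all. *)
Lemma is_dderiveM f g t a b : is_dderive f t a -> is_dderive g t b ->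
  is_dderive (fun u => f u * g u) t (a * g t + f t * b).
Proof.
move=> [fa fa'] [gb gb']; split.
  by apply: (is_derive_eq (is_deriveM fa gb)); rewrite /GRing.scale /=; ring.
apply: (is_derive_eq (is_deriveD (is_deriveM fa gb') (is_deriveM fa' gb))).
by rewrite /GRing.scale /=; ring.
Qed.

(** The dual part of [dsin (f u)] already contains a cosine, so its derivative needs the chain rules
    for both [sin] and [cos]. *)
Lemma is_dderive_dsin f t a : is_dderive f t a ->
  is_dderive (fun u => dsin (f u)) t (dcos (f t) * a).
Proof.
move=> [fa fa'].
have fs := is_derive1_comp (is_derive_sin (dre (f t))) fa.
have fc := is_derive1_comp (is_derive_cos (dre (f t))) fa.
split.
  by apply: (is_derive_eq fs); rewrite dcosE.
under eq_fun do rewrite dsinE.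
apply: (is_derive_eq (is_deriveM fa' fc)).
by rewrite dcosE /GRing.scale /=; ring.
Qed.

Lemma is_dderive_dcos f t a : is_dderive f t a ->
  is_dderive (fun u => dcos (f u)) t (- dsin (f t) * a).
Proof.
move=> [fa fa'].
have fs := is_derive1_comp (is_derive_sin (dre (f t))) fa.
have fc := is_derive1_comp (is_derive_cos (dre (f t))) fa.
split.
  by under eq_fun do rewrite dcosE; apply: (is_derive_eq fc); rewrite dsinE.
under eq_fun do rewrite dcosE.
apply: (is_derive_eq (is_deriveN (is_deriveM fa' fs))).
by rewrite dsinE /GRing.scale /=; ring.
Qed.

(** The dual parts of the two squares are opposite, which leaves the real identity. *)
Lemma dcos2Ddsin2 a : dcos a ^+ 2 + dsin a ^+ 2 = 1.
Proof.
rewrite dcosE dsinE !expr2; apply: dualP => /=; last by ring.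
by rewrite -!expr2 cos2Dsin2.
Qed.

(** The relations between the two frames hold only on the parameter set; a local equality is enough
    to differentiate them. *)
Lemma near_eq_vderive U V t : {near t, U =1 V} -> vderive U t = vderive V t.
Proof.
move=> UV; apply/rowP => i; rewrite !mxE; apply: dualP; rewrite /= !derive1E;
  by apply: near_eq_derive; apply: filterS UV => u ->.
Qed.

Lemma vderiveE U t i : vderive U t 0 i = dderive (fun u => U u 0 i) t.
Proof. exact: mxE. Qed.

Lemma vderive_lincomb f g U V t a b :
    is_dderive f t a -> is_dderive g t b -> vderivable U t -> vderivable V t ->
  vderive (fun u => f u *: U u + g u *: V u) t =
    a *: U t + f t *: vderive U t + (b *: V t + g t *: vderive V t).
Proof.
move=> fa gb dU dV; apply/rowP => i.
rewrite addvE (lincombE a (f t)) (lincombE b (g t)) !vderiveE.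
under [X in dderive X]eq_fun do rewrite lincombE.
apply: is_dderive_val; apply: is_dderiveD.
- exact: is_dderiveM fa (dderivableP (dU i)).
- exact: is_dderiveM gb (dderivableP (dV i)).
Qed.

Lemma enorm_neq0 (v : 'rV[R]_3) : v != 0 -> enorm v != 0.
Proof.
(* [Num.sqrt] is 0 on all nonpositive reals, so only [dotv v v <= 0] is obtained; equality comes
   from the sum being one of squares. *)
apply: contraNneq => /eqP; rewrite /enorm sqrtr_eq0 => v_le0.
have sq_ge0 (i : 'I_3) : true -> 0 <= v 0 i * v 0 i.
  by rewrite -expr2 sqr_ge0.
have /eqP : dotv v v = 0 by apply/le_anti; rewrite v_le0 sumr_ge0.
rewrite psumr_eq0 // => /allP v0; apply/eqP/rowP => i; rewrite mxE.
by have := v0 i (mem_index_enum i); rewrite /= mulf_eq0 orbb => /eqP.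
Qed.

Section FrenetFrame.
Variables (I : set R) (o : bool) (C : frenet_data R) (t : R).
Hypotheses (frenetC : is_frenet I o C) (It : I t).

(** A dual number is invertible when its real part is nonzero; here that part is the Euclidean speed
    of a regular curve. *)
Lemma dderive_arclen_unit : dderive (arclen C) t \is a GRing.unit.
Proof.
rewrite (arclenE frenetC It); apply: enorm_neq0.
exact: curve_regular frenetC _ It.
Qed.

(** Brings derivatives along two different arc lengths back to the common parameter. *)
Lemma vdiff_arclenE V :
  vderive V t = dderive (arclen C) t *: vdiff (arclen C) V t.
Proof. by rewrite /vdiff scalerA mulrV ?scale1r // dderive_arclen_unit. Qed.

End FrenetFrame.

End DualCalculus.

Theorem theorem8 (R : realType) (I : set R) (o o1 : bool)
    (C C1 : frenet_data R) (theta : R -> dualnum R)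
    (openI : open I) (itvI : is_interval I)
    (frenetC : is_frenet I o C) (frenetC1 : is_frenet I o1 C1)
    (mannheim : mannheim_pair I C C1)
    (angle : is_dual_angle I C C1 theta) :
  forall t : R, I t ->
    [/\ curvature C1 t = - ddiff (arclen C1) theta t,
        torsion C1 t =
          dsin (theta t) * curvature C t * ddiff (arclen C1) (arclen C) t
          - dcos (theta t) * torsion C t * ddiff (arclen C1) (arclen C) t,
        curvature C t =
          dsin (theta t) * torsion C1 t * ddiff (arclen C) (arclen C1) t
      & torsion C t =
          - (dcos (theta t) * torsion C1 t * ddiff (arclen C) (arclen C1) t)].
Proof.
move=> t It.
(* Openness of [I] turns the pointwise relations on [I] into relations near [t]. *)
have nearI : \forall u \near t, I u by apply: open_nbhs_nbhs; split.
have [dtheta tE bE] := angle t It.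
have nb1 : normal C t = binormal C1 t by have [/(_ t It) []] := mannheim.
have dn : vderive (normal C) t = vderive (binormal C1) t.
  apply: near_eq_vderive; apply: filterS nearI => u Iu.
  by have [/(_ u Iu) []] := mannheim.
have dt : vderive (tangent C) t = vderive (fun u =>
    dcos (theta u) *: tangent C1 u + dsin (theta u) *: normal C1 u) t.
  by apply: near_eq_vderive; apply: filterS nearI => u /angle[].
have theta' := dderivableP dtheta.
rewrite (vderive_lincomb (is_dderive_dcos theta')
  (is_dderive_dsin theta') (tangent_derivable frenetC1 It)
  (normal_derivable frenetC1 It)) in dt.
(* Each parameter derivative becomes a speed times an arc-length derivative, which the Frenet
   equations then evaluate. *)
rewrite (vdiff_arclenE frenetC It (normal C))
  (vdiff_arclenE frenetC1 It (binormal C1)) in dn.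
rewrite (vdiff_arclenE frenetC It (tangent C))
  (vdiff_arclenE frenetC1 It (tangent C1))
  (vdiff_arclenE frenetC1 It (normal C1)) in dt.
rewrite (frenet_normal frenetC It) (frenet_binormal frenetC1 It) in dn.
rewrite (frenet_tangent frenetC It) (frenet_tangent frenetC1 It)
  (frenet_normal frenetC1 It) nb1 in dt.
apply: (mannheim_frames _ _ _ tE bE _ _ _ _ _ _ _ dn dt).
- exact: dderive_arclen_unit frenetC It.
- exact: dderive_arclen_unit frenetC1 It.
- exact: dcos2Ddsin2.
- exact: tangent_unit frenetC _ It.
- exact: binormal_unit frenetC _ It.
- exact: tangent_binormal frenetC _ It.
- exact: tangent_unit frenetC1 _ It.
- exact: normal_unit frenetC1 _ It.
- exact: tangent_normal frenetC1 _ It.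
- by rewrite -nb1 (normal_binormal frenetC It).
Qed.
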